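(* Consider the problem of scheduling $n$ tasks on two unrelated machines, where machine $i\in\{1,2\}$ needs time $t^i_j>0$ to run task $j$. The Generalized Randomly Biased Mechanism (GBM), run with parameters $\alpha=1.4844$, $\beta=1.1854$, $r=0.7932$, is universally truthful, and for every instance $t=(t^1,t^2)$ its expected makespan is at most $1.6737$ times the optimal makespan of $t$.
   Context: Setting: there are $2$ machines and $n$ tasks; machine $i$ is a selfish agent whose private type is the vector $t^i=(t^i_j)_{j\in[n]}$, where $t^i_j$ is the running time of task $j$ on machine $i$. A mechanism receives reported types, outputs an allocation $x=(x^1,x^2)$ with $x^i_j\in\{0,1\}$, each task assigned to exactly one machine, and payments $p=(p^1,p^2)$. The utility of agent $i$ is $p^i-\sum_j x^i_j t^i_j$ (computed with the true running times). The makespan of an allocation is $\max_i\sum_j x^i_jt^i_j$; the optimal makespan is the minimum over all allocations. A randomized mechanism has approximation ratio $c$ if for every instance the expected makespan of its allocation is at most $c$ times the optimal makespan. A randomized mechanism is universally truthful if, for every fixing of its random bits, the resulting deterministic mechanism is truthful, i.e. for every agent, reporting the true type maximizes that agent's utility no matter what the other agent reports. GBM with parameters $\alpha>\beta\ge 1>r\ge 1/2$: start with $x^i_j=0$ for all $i,j$ and $p^1=p^2=0$. Independently for each task $j$, draw $s_j$ equal to $\alpha$ with probability $1-r$, $\beta$ with probability $r-1/2$, $1/\beta$ with probability $r-1/2$, and $1/\alpha$ with probability $1-r$. If (reported) $t^1_j<s_j t^2_j$, set $x^1_j=1$ and add $s_jt^2_j$ to $p^1$; otherwise set $x^2_j=1$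 and add $s_j^{-1}t^1_j$ to $p^2$.
   Formalization: The bound proved is 1.67370356 instead of 1.6737, which is false as an exact value: for t^1=(1, 1.4844-e), t^2=(1.1854, 1) with small e>0 the optimal makespan is 1 but the expected makespan is 1.67370356-0.2068e > 1.6737. *)

(* Defs.v *)
From HB Require Import structures.
From mathcomp Require Import all_boot all_order all_algebra.
From mathcomp Require Import lra.

Set Implicit Arguments.
Unset Strict Implicit.
Unset Printing Implicit Defensive.

Import Order.TTheory GRing.Theory Num.Theory.
Local Open Scope ring_scope.

Notation machine := 'I_2.
Notation machine1 := (ord0 : machine).
Notation machine2 := (ord_max : machine).

Section Scheduling.
Variables (R : realFieldType) (n : nat).

Definition type_vector := 'I_n -> R.

(* [t i j] is the running time of task [j] on machine [i]; used both for true
   instances and for reports. *)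
Definition profile := machine -> type_vector.

Definition positive_type (u : type_vector) : Prop := forall j, 0 < u j.

Definition positive_profile (t : profile) : Prop :=
  forall i, positive_type (t i).

(* [x j] is the machine that runs task [j]: x^i_j = 1 iff [x j == i]. *)
Definition allocation := {ffun 'I_n -> machine}.

Definition load (x : allocation) (i : machine) (u : type_vector) : R :=
  \sum_(j < n | x j == i) u j.

Definition makespan (t : profile) (x : allocation) : R :=
  Num.max (load x machine1 (t machine1)) (load x machine2 (t machine2)).

(* The default of the minimum is itself the makespan of an allocation. *)
Definition opt_makespan (t : profile) : R :=
  \big[Num.min/makespan t [ffun=> machine1]]_(x : allocation) makespan t x.

Record outcome := Outcome {
  alloc : allocation;
  payment : machine -> R }.

Definition mechanism := profile -> outcome.

Definition utility (i : machine) (u : type_vector) (o : outcome) : R :=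
  payment o i - load (alloc o) i u.

(* [t i] is the true type of agent [i], the other entry of [t] is an arbitrary
   report of the other agent, and [b] is a misreport of agent [i]. *)
Definition truthful (M : mechanism) : Prop :=
  forall (t : profile) (i : machine) (b : type_vector),
    positive_profile t -> positive_type b ->
    utility i (t i) (M [eta t with i |-> b]) <= utility i (t i) (M t).

Record randomized_mechanism := RandomizedMechanism {
  seed : finType;
  seed_prob : seed -> R;
  run : seed -> mechanism;
  seed_prob_ge0 : forall w, 0 <= seed_prob w;
  seed_prob_sum1 : \sum_w seed_prob w = 1 }.

Definition universally_truthful (M : randomized_mechanism) : Prop :=
  forall w : seed M, truthful (run w).

Definition expected_makespan (M : randomized_mechanism) (t : profile) : R :=
  \sum_(w : seed M) seed_prob w * makespan t (alloc (run w t)).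

Definition approximation_ratio (M : randomized_mechanism) (c : R) : Prop :=
  forall t : profile, positive_profile t ->
    expected_makespan M t <= c * opt_makespan t.

Definition biased_mechanism (s : 'I_n -> R) : mechanism := fun t =>
  let x : allocation :=
    [ffun j => if t machine1 j < s j * t machine2 j
               then machine1 else machine2] in
  Outcome x (fun i =>
    if i == machine1 then \sum_(j < n | x j == machine1) s j * t machine2 j
    else \sum_(j < n | x j == machine2) (s j)^-1 * t machine1 j).

Definition gbm_parameters (alpha beta r : R) : bool :=
  [&& beta < alpha, 1 <= beta, r < 1 & 2^-1 <= r].

Definition bias (alpha beta : R) (k : 'I_4) : R :=
  nth 0 [:: alpha; beta; beta^-1; alpha^-1] k.

Definition bias_prob (r : R) (k : 'I_4) : R :=
  nth 0 [:: 1 - r; r - 2^-1; r - 2^-1; 1 - r] k.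

(* The biases of the tasks are independent, so a seed has product weight. *)
Definition gbm_prob (r : R) (w : {ffun 'I_n -> 'I_4}) : R :=
  \prod_(j < n) bias_prob r (w j).

Lemma bias_prob_ge0 alpha beta r k :
  gbm_parameters alpha beta r -> 0 <= bias_prob r k.
Proof.
case/and4P=> _ _ r1 r2.
case: k => [[|[|[|[|//]]]] ?]; rewrite /bias_prob /= subr_ge0 // ltW //.
Qed.

Lemma gbm_prob_ge0 alpha beta r w :
  gbm_parameters alpha beta r -> 0 <= gbm_prob r w.
Proof. by move=> h; apply: prodr_ge0 => j _; apply: bias_prob_ge0 h. Qed.

Lemma gbm_prob_sum1 r : \sum_w gbm_prob r w = 1.
Proof.
rewrite -(bigA_distr_bigA (fun _ k => bias_prob r k)) big1 // => j _.
by rewrite !big_ord_recl big_ord0 /bias_prob /=; lra.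
Qed.

Definition gbm (alpha beta r : R) (h : gbm_parameters alpha beta r) :
    randomized_mechanism :=
  @RandomizedMechanism {ffun 'I_n -> 'I_4} (gbm_prob r)
    (fun w => biased_mechanism (fun j => bias alpha beta (w j)))
    (fun w => gbm_prob_ge0 w h) (gbm_prob_sum1 r).

End Scheduling.

Arguments gbm_parameters {R} alpha beta r.
Arguments gbm {R} n alpha beta r h.

(* alpha = 1.4844, beta = 1.1854, r = 0.7932, written in base 100 because large
   numerals in a ring are unary. *)
Lemma gbm_parameters_ok (R : realFieldType) :
  gbm_parameters (1 + 48 / 100 + 44 / 100 ^+ 2)
    (1 + 18 / 100 + 54 / 100 ^+ 2) (79 / 100 + 32 / 100 ^+ 2 : R).
Proof. by rewrite /gbm_parameters; apply/and4P; split; lra. Qed.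

(* Main.v *)
Require Import Defs.
From mathcomp Require Import all_boot all_order all_algebra.
From mathcomp Require Import lra ring.
Import Order.TTheory GRing.Theory Num.Theory.
Local Open Scope ring_scope.

Set Implicit Arguments.
Unset Strict Implicit.
Unset Printing Implicit Defensive.

(** Fix an allocation [x] with makespan [T].  For each outcome of the biases the
    makespan is a convex function of the running times, and each machine has
    load at most [T] under [x].  Hence it is at most a convex combination of
    makespans of two-task instances: a task of length [T] that [x] runs on
    machine 1 and one of length [T] that [x] runs on machine 2.  Their biases are
    independent, so the expected makespan of such an instance depends only on
    the probabilities that the two tasks are run on the other machine and on
    their slowdowns there.  The thresholds leave five possibilities per task;
    the largest of the 25 resulting values is the ratio, attained at
    slowdowns [alpha] and [beta]. *)

(** * Finite mixtures and convexity of the maximum *)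

Lemma big_option_sum (V : nmodType) (I : finType) (F : option I -> V) :
  \sum_o F o = F None + \sum_i F (Some i).
Proof.
rewrite (bigD1 None) //=; congr (_ + _).
rewrite (reindex_omap Some id); last by case.
by apply: eq_bigl => i; rewrite /= eqxx.
Qed.

(** Since both weights sum to 1, each argument of the maximum is an average over the product
    distribution [mu i * nu j]; a maximum of averages is at most the average of the maxima. *)
Lemma max_mixture (R : realFieldType) (I J : finType) (mu u u' : I -> R)
    (nu v v' : J -> R) :
  (forall i, 0 <= mu i) -> (forall j, 0 <= nu j) ->
  \sum_i mu i = 1 -> \sum_j nu j = 1 ->
  Num.max (\sum_i mu i * u i + \sum_j nu j * v j)
          (\sum_i mu i * u' i + \sum_j nu j * v' j) <=
  \sum_i \sum_j mu i * nu j * Num.max (u i + v j) (u' i + v' j).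
Proof.
move=> mu0 nu0 mu1 nu1.
have E f g : \sum_i mu i * f i + \sum_j nu j * g j =
    \sum_i \sum_j mu i * nu j * (f i + g j).
  rewrite -[X in X + _]mulr1 -nu1 -[X in _ + X]mul1r -mu1 !big_distrlr /=.
  rewrite -big_split; apply: eq_bigr => i _; rewrite -big_split.
  by apply: eq_bigr => j _ /=; ring.
rewrite !E ge_max; apply/andP; split; apply: ler_sum => i _;
  apply: ler_sum => j _; rewrite ler_wpM2l ?mulr_ge0 // le_max lexx ?orbT //.
Qed.

(** * Truthfulness for fixed biases *)

Section Truthfulness.
Variables (R : realFieldType) (n : nat).

Lemma le_sum_profitable (P Q : pred 'I_n) (v : 'I_n -> R) :
  (forall j, P j -> 0 <= v j) -> (forall j, ~~ P j -> v j <= 0) ->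
  \sum_(j | Q j) v j <= \sum_(j | P j) v j.
Proof.
move=> vP vN; rewrite big_mkcond [leRHS]big_mkcond; apply: ler_sum => j _.
by case: (boolP (P j)) => [/vP|/vN]; case: (Q j).
Qed.

Lemma machine_case (i : machine) : i = machine1 \/ i = machine2.
Proof. by case: i => [[|[|//]] h]; [left|right]; apply: val_inj. Qed.

(* Tasks are priced separately, at a price that does not depend on the report of
   the winner, and a truthful agent wins a task exactly when it is profitable. *)
Lemma biased_mechanism_truthful (s : 'I_n -> R) :
  (forall j, 0 < s j) -> truthful (biased_mechanism s).
Proof.
move=> s0 t i b _ _; rewrite /utility /load /=.
have [->|->] := machine_case i; rewrite /= -!sumrB.
  set v := fun j => s j * t machine2 j - t machine1 j.
  rewrite (@le_sum_profitable _ _ v) // => j; rewrite !ffunE /v /=.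
    by case: ltP => // /ltW; rewrite subr_ge0.
  by case: ltP => //; rewrite subr_le0.
set v := fun j => (s j)^-1 * t machine1 j - t machine2 j.
have vE j : (0 <= v j) = (s j * t machine2 j <= t machine1 j).
  by rewrite subr_ge0 ler_pdivlMl.
rewrite (@le_sum_profitable _ _ v) // => j; rewrite !ffunE /=.
  by rewrite vE; case: ltP.
by case: ltP => // h _; apply/ltW; rewrite ltNge vE -ltNge.
Qed.

End Truthfulness.

(** * Independence of the biases of distinct tasks *)

Section Independence.
Variables (R : realFieldType) (n : nat) (r : R).

Definition expect (f : {ffun 'I_n -> 'I_4} -> R) : R :=
  \sum_w gbm_prob r w * f w.

Lemma expect_prod (g : 'I_n -> 'I_4 -> R) :
  expect (fun w => \prod_j g j (w j)) =
  \prod_j \sum_k bias_prob r k * g j k.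
Proof.
by rewrite bigA_distr_bigA; apply: eq_bigr => w _; rewrite -big_split.
Qed.

Lemma sum_bias_prob : \sum_k bias_prob r k = 1.
Proof. by rewrite !big_ord_recl big_ord0 /bias_prob /=; lra. Qed.

Lemma expect_single (g : 'I_4 -> R) (j : 'I_n) :
  expect (fun w => g (w j)) = \sum_k bias_prob r k * g k.
Proof.
(* Padding with factors 1 gives a product over all tasks, whose expectation factorises by
   [expect_prod]. *)
transitivity (expect (fun w => \prod_i (if i == j then g (w i) else 1))).
  by apply: eq_bigr => w _; rewrite -big_mkcond big_pred1_eq.
rewrite (expect_prod (fun i k => if i == j then g k else 1)).
rewrite (bigD1 j) //= eqxx [X in _ * X]big1 ?mulr1 // => i /negPf ->.
by rewrite -[RHS]sum_bias_prob; apply: eq_bigr => k _; rewrite mulr1.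
Qed.

Lemma expect_indep (g h : 'I_4 -> R) (j k : 'I_n) : j != k ->
  expect (fun w => g (w j) * h (w k)) =
  expect (fun w => g (w j)) * expect (fun w => h (w k)).
Proof.
move=> jk; rewrite !expect_single.
pose f i l := (if i == j then g l else 1) * (if i == k then h l else 1).
transitivity (expect (fun w => \prod_i f i (w i))).
  apply: eq_bigr => w _; rewrite /f big_split /=.
  by rewrite -!big_mkcond !big_pred1_eq.
rewrite expect_prod (bigD1 j) //= (bigD1 k) /=; last by rewrite eq_sym.
rewrite [X in _ * (_ * X)]big1 => [|i /andP[/negPf ij /negPf ik]].
  rewrite mulr1 /f !eqxx (negPf jk) [k == j]eq_sym (negPf jk); congr (_ * _).
    by apply: eq_bigr => l _; rewrite mulr1.
  by apply: eq_bigr => l _; rewrite mul1r.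
rewrite -[RHS]sum_bias_prob.
by apply: eq_bigr => l _; rewrite /f ij ik !mulr1.
Qed.

End Independence.

(** * Misrun probability by slowdown interval *)

Section Classes.
Variables (R : realFieldType) (alpha beta r : R).
Hypothesis ok : gbm_parameters alpha beta r.

(* [q] is the probability that the mechanism runs a task on the machine not
   chosen by the reference allocation, and [rho] is the factor by which the task
   is slower there; one case for each interval between the thresholds. *)
Definition misrun_class (q rho : R) : Prop :=
  [\/ q = 0, q = 1 - r /\ rho <= alpha, q = 2^-1 /\ rho <= beta |
   q = r /\ beta * rho <= 1 \/ q = 1 /\ alpha * rho <= 1].

Lemma bias_gt0 k : 0 < bias alpha beta k.
Proof.
case/and4P: ok => ab b1 _ _.
have b0 : 0 < beta by apply: lt_le_trans b1.
have a0 : 0 < alpha by apply: lt_trans ab.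
by case: k => [[|[|[|[|//]]]] h]; rewrite /bias /= ?invr_gt0.
Qed.

Lemma misrun_class_machine1 (rho : R) : 0 < rho ->
  misrun_class
    (\sum_k bias_prob r k * (bias alpha beta k * rho <= 1)%R%:R) rho.
Proof.
move=> rho0; case/and4P: ok => ab b1 _ _.
have b0 : 0 < beta by apply: lt_le_trans b1.
have a0 : 0 < alpha by apply: lt_trans ab.
rewrite !big_ord_recl big_ord0 /bias_prob /bias /= !ler_pdivrMl // !mulr1.
rewrite /misrun_class.
case: (leP (alpha * rho) 1) => [h|h1]; case: (leP (beta * rho) 1) => [h2|h2];
 case: (leP rho beta) => h3; case: (leP rho alpha) => h4;
 rewrite ?mulr1 ?mulr0 ?addr0 ?add0r //=.
(* As [1/alpha < 1/beta <= beta < alpha], only 5 of the 16 combinations are consistent. *)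
all: try (exfalso; nra).
- by constructor 4; right; split; [lra|].
- by constructor 4; left; split; [lra|].
- by constructor 3; split; [lra|].
- by constructor 2; split; [lra|].
- by constructor 1.
Qed.

(** Inverting a bias preserves its law, so the classes are those of machine 1; the opposite
    treatment of ties is absorbed by the non-strict bounds in [misrun_class]. *)
Lemma misrun_class_machine2 (rho : R) : 0 < rho ->
  misrun_class (\sum_k bias_prob r k * (rho < bias alpha beta k)%R%:R) rho.
Proof.
move=> rho0; case/and4P: ok => ab b1 _ _.
have b0 : 0 < beta by apply: lt_le_trans b1.
have a0 : 0 < alpha by apply: lt_trans ab.
rewrite !big_ord_recl big_ord0 /bias_prob /bias /=.
rewrite -[beta^-1]mulr1 -[alpha^-1]mulr1 !ltr_pdivlMl //.
rewrite /misrun_class.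
case: (ltP (alpha * rho) 1) => [h|h1]; case: (ltP (beta * rho) 1) => [h2|h2];
 case: (ltP rho beta) => h3; case: (ltP rho alpha) => h4;
 rewrite ?mulr1 ?mulr0 ?addr0 ?add0r //=.
all: try (exfalso; nra).
- by constructor 4; right; split; [lra|apply: ltW].
- by constructor 4; left; split; [lra|apply: ltW].
- by constructor 3; split; [lra|apply: ltW].
- by constructor 2; split; [lra|apply: ltW].
- by constructor 1.
Qed.

End Classes.

(** * Reduction to two-task instances *)

Section TwoTaskReduction.
Variables (R : realFieldType) (n : nat) (alpha beta r : R).
Hypothesis ok : gbm_parameters alpha beta r.
Variables (t : profile R n) (x : allocation n).
Hypothesis tpos : positive_profile t.
Hypothesis T_gt0 : 0 < makespan t x.
Notation T := (makespan t x).
Notation s w j := (bias alpha beta ((w : {ffun 'I_n -> 'I_4}) j)).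
Implicit Types o p : option 'I_n.

(* [None] is a fictitious task, always run where [x] puts it, whose share makes
   up the difference between the load of machine [i] and the makespan. *)
Definition share (i : machine) o : R :=
  if o is Some j then (if x j == i then t i j / T else 0)
  else 1 - load x i (t i) / T.

Definition slowdown1 o : R :=
  if o is Some j then t machine2 j / t machine1 j else 0.
Definition slowdown2 o : R :=
  if o is Some j then t machine1 j / t machine2 j else 0.

Definition misrun1 o (w : {ffun 'I_n -> 'I_4}) : bool :=
  if o is Some j then s w j * t machine2 j <= t machine1 j else false.
Definition misrun2 o (w : {ffun 'I_n -> 'I_4}) : bool :=
  if o is Some j then t machine1 j < s w j * t machine2 j else false.

(** Loads are in units of [T], so each task costs 1 where [x] puts it. *)
Definition pair_makespan o p w : R :=
  Num.max ((~~ misrun1 o w)%:R + (misrun2 p w)%:R * slowdown2 p)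
          ((misrun1 o w)%:R * slowdown1 o + (~~ misrun2 p w)%:R).

Lemma share_ge0 i o : 0 <= share i o.
Proof.
case: o => [j|] /=; first by case: ifP => // _; rewrite divr_ge0 ?ltW // tpos.
rewrite subr_ge0 ler_pdivrMr // mul1r le_max.
by have [->|->] := machine_case i; rewrite lexx ?orbT.
Qed.

Lemma sum_share i : \sum_o share i o = 1.
Proof. by rewrite big_option_sum /= -big_mkcond -mulr_suml subrK. Qed.

(** Real tasks match the load term by term; the only slack is the nonnegative padding
    [T * share machine1 None]. *)
Lemma load1_le w :
  load (alloc (biased_mechanism (fun j => s w j) t)) machine1 (t machine1) <=
  T * (\sum_o share machine1 o * (~~ misrun1 o w)%:R +
       \sum_p share machine2 p * ((misrun2 p w)%:R * slowdown2 p)).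
Proof.
have T0 := lt0r_neq0 T_gt0.
rewrite !big_option_sum mul0r mulr0 add0r mulr1 -addrA -big_split mulrDr.
apply: ler_wpDl; first by rewrite mulr_ge0 ?share_ge0 ?ltW.
rewrite mulr_sumr /load big_mkcond.
rewrite le_eqVlt; apply/orP; left; apply/eqP; apply: eq_bigr => j _ /=.
have t2 := lt0r_neq0 (tpos machine2 j).
rewrite ffunE; have [->|->] := machine_case (x j);
  case: ltP => _ /=; rewrite ?(mul0r, mulr0, addr0, add0r) //;
  by field; rewrite ?T0 ?t2.
Qed.

Lemma load2_le w :
  load (alloc (biased_mechanism (fun j => s w j) t)) machine2 (t machine2) <=
  T * (\sum_o share machine1 o * ((misrun1 o w)%:R * slowdown1 o) +
       \sum_p share machine2 p * (~~ misrun2 p w)%:R).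
Proof.
have T0 := lt0r_neq0 T_gt0.
rewrite !big_option_sum mul0r mulr0 add0r mulr1 addrCA -big_split mulrDr.
apply: ler_wpDl; first by rewrite mulr_ge0 ?share_ge0 ?ltW.
rewrite mulr_sumr /load big_mkcond.
rewrite le_eqVlt; apply/orP; left; apply/eqP; apply: eq_bigr => j _ /=.
have t1 := lt0r_neq0 (tpos machine1 j).
rewrite ffunE; have [->|->] := machine_case (x j);
  case: ltP => _ /=; rewrite ?(mul0r, mulr0, addr0, add0r) //;
  by field; rewrite ?T0 ?t1.
Qed.

Lemma makespan_le_mixture w :
  makespan t (alloc (biased_mechanism (fun j => s w j) t)) <=
  T * \sum_o \sum_p
    share machine1 o * share machine2 p * pair_makespan o p w.
Proof.
have := max_mixture (fun o => (~~ misrun1 o w)%:R)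
  (fun o => (misrun1 o w)%:R * slowdown1 o)
  (fun p => (misrun2 p w)%:R * slowdown2 p) (fun p => (~~ misrun2 p w)%:R)
  (share_ge0 machine1) (share_ge0 machine2) (sum_share _) (sum_share _).
rewrite -(ler_pM2l T_gt0); apply: le_trans; rewrite maxr_pMr ?(ltW T_gt0) //.
by rewrite ge_max !le_max load1_le load2_le orbT.
Qed.

Lemma slowdown1_ge0 o : 0 <= slowdown1 o.
Proof. by case: o => //= j; rewrite divr_ge0 ?ltW ?tpos. Qed.

Lemma slowdown2_ge0 o : 0 <= slowdown2 o.
Proof. by case: o => //= j; rewrite divr_ge0 ?ltW ?tpos. Qed.

Let expect0 : @expect R n r (fun=> 0) = 0.
Proof. by rewrite /expect big1 // => w _; rewrite mulr0. Qed.

(** The makespan is 1 if neither task is misrun, 1 plus the slowdown if exactly one is, and the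
    larger slowdown if both are. This is a polynomial in the two indicators, and independence turns
    the mean of their product into [a * b]. *)
Lemma expect_pair_makespan o p :
  (forall j, ~ (o = Some j /\ p = Some j)) ->
  let a := expect r (fun w => (misrun1 o w)%:R) in
  let b := expect r (fun w => (misrun2 p w)%:R) in
  expect r (pair_makespan o p) =
  1 + a * slowdown1 o + b * slowdown2 p +
    a * b *
      (Num.max (slowdown2 p) (slowdown1 o) - 1 - slowdown1 o - slowdown2 p).
Proof.
move=> op a b.
have indep : expect r (fun w => (misrun1 o w)%:R * (misrun2 p w)%:R) = a * b.
  rewrite /a /b {a b}; case: o p op => [j|] [k|] op /=.
  - apply: (expect_indep r
      (fun l => (bias alpha beta l * t machine2 j <= t machine1 j)%R%:R)
      (fun l => (t machine1 k < bias alpha beta l * t machine2 k)%R%:R)).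
    by apply/eqP => jk; apply: (op j); rewrite jk.
  - by rewrite expect0 mulr0 /expect big1 // => w _; rewrite !mulr0.
  - by rewrite expect0 mul0r /expect big1 // => w _; rewrite ?mul0r !mulr0.
  - by rewrite expect0 mul0r /expect big1 // => w _; rewrite ?mul0r !mulr0.
rewrite -indep -[X in X + _ + _ + _](@gbm_prob_sum1 R n r) /a /b /expect.
rewrite !mulr_suml -!big_split; apply: eq_bigr => w _ /=; rewrite /pair_makespan.
have := slowdown1_ge0 o; have := slowdown2_ge0 p.
case: (misrun1 o w); case: (misrun2 p w) => /= s2 s1;
  rewrite !(mul1r, mul0r, mulr0, mulr1, add0r, addr0); first by ring.
all: by case: leP; lra.
Qed.

Lemma misrun1_class o :
  misrun_class alpha beta r
    (expect r (fun w => (misrun1 o w)%:R)) (slowdown1 o).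
Proof.
case: o => [j|] /=; last by constructor 1; rewrite expect0.
have := misrun_class_machine1 ok (divr_gt0 (tpos machine2 j) (tpos machine1 j)).
rewrite -(expect_single r (fun k =>
  (bias alpha beta k * (t machine2 j / t machine1 j) <= 1)%R%:R) j).
congr misrun_class; apply: eq_bigr => w _.
by rewrite mulrA ler_pdivrMr ?mul1r ?tpos.
Qed.

Lemma misrun2_class o :
  misrun_class alpha beta r
    (expect r (fun w => (misrun2 o w)%:R)) (slowdown2 o).
Proof.
case: o => [j|] /=; last by constructor 1; rewrite expect0.
have := misrun_class_machine2 ok (divr_gt0 (tpos machine1 j) (tpos machine2 j)).
rewrite -(expect_single r (fun k =>
  (t machine1 j / t machine2 j < bias alpha beta k)%R%:R) j).
congr misrun_class; apply: eq_bigr => w _.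
by rewrite ltr_pdivrMr ?tpos.
Qed.

Variable c : R.
Hypothesis two_tasks : forall q rho p sigma : R,
  misrun_class alpha beta r q rho -> misrun_class alpha beta r p sigma ->
  1 + q * rho + p * sigma +
    q * p * (Num.max sigma rho - 1 - rho - sigma) <= c.

Lemma expected_makespan_le : expected_makespan (gbm n alpha beta r ok) t <= c * T.
Proof.
rewrite /expected_makespan /=.
apply: (@le_trans _ _ (expect r (fun w => T * \sum_o \sum_p
    share machine1 o * share machine2 p * pair_makespan o p w))).
  apply: ler_sum => w _.
  by rewrite ler_wpM2l ?(gbm_prob_ge0 _ ok) ?makespan_le_mixture.
have -> : expect r (fun w => T * \sum_o \sum_p
    share machine1 o * share machine2 p * pair_makespan o p w) =
  T * \sum_o \sum_p share machine1 o * share machine2 p *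
    expect r (pair_makespan o p).
  rewrite /expect; under eq_bigr do rewrite mulrCA mulr_sumr.
  rewrite -mulr_sumr exchange_big; congr (_ * _); apply: eq_bigr => o _ /=.
  under eq_bigr do rewrite mulr_sumr.
  rewrite exchange_big; apply: eq_bigr => p _ /=; rewrite mulr_sumr.
  by apply: eq_bigr => w _; rewrite mulrCA.
rewrite mulrC ler_wpM2r ?(ltW T_gt0) //.
have <- : \sum_o \sum_p share machine1 o * share machine2 p * c = c.
  under eq_bigr do rewrite -mulr_suml.
  by rewrite -mulr_suml -big_distrlr /= !sum_share !mul1r.
apply: ler_sum => o _; apply: ler_sum => p _.
(* A task paired with itself would break independence, but [x] runs it on one machine only, so one
   of its shares is 0. *)
have [op0|op0] := eqVneq (share machine1 o * share machine2 p) 0.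
  by rewrite op0 !mul0r.
rewrite ler_wpM2l ?mulr_ge0 ?share_ge0 // expect_pair_makespan.
  exact: two_tasks (misrun1_class o) (misrun2_class p).
move=> j [oj pj]; move: op0; rewrite oj pj /=.
by have [->|->] := machine_case (x j); rewrite ?mul0r ?mulr0 eqxx.
Qed.

End TwoTaskReduction.

(** * Passage to the optimum and the numerical bound *)

Lemma opt_makespan_ge (R : realFieldType) (n : nat) (t : profile R n) (c e : R) :
  0 <= c -> (forall x, e <= c * makespan t x) -> e <= c * opt_makespan t.
Proof.
move=> c0 h; rewrite /opt_makespan.
by elim/big_ind: _ => // u v hu hv; rewrite minr_pMr // le_min hu hv.
Qed.

Lemma makespan_gt0 (R : realFieldType) (n : nat) (t : profile R n.+1) x :
  positive_profile t -> 0 < makespan t x.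
Proof.
move=> tpos.
have : 0 < load x (x ord0) (t (x ord0)).
  rewrite /load (bigD1 ord0) //= ltr_pwDl ?tpos // sumr_ge0 // => j _.
  by rewrite ltW ?tpos.
by rewrite lt_max; have [->|->] := machine_case (x ord0) => ->; rewrite ?orbT.
Qed.

Lemma gbm_approximation (R : realFieldType) (n : nat) (alpha beta r c : R)
    (ok : gbm_parameters alpha beta r) : 0 <= c ->
  (forall q rho p sigma,
    misrun_class alpha beta r q rho -> misrun_class alpha beta r p sigma ->
    1 + q * rho + p * sigma +
      q * p * (Num.max sigma rho - 1 - rho - sigma) <= c) ->
  approximation_ratio (gbm n alpha beta r ok) c.
Proof.
move=> c0 two_tasks t tpos; apply: opt_makespan_ge => // x.
case: n t tpos x => [|n] t tpos x; last first.
  by apply: expected_makespan_le => //; apply: makespan_gt0.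
(* Without tasks the makespan is 0 and cannot serve as unit of load. *)
have Z y : makespan t y = 0 by rewrite /makespan /load !big_ord0 maxxx.
rewrite /expected_makespan big1 ?Z ?mulr0 // => w _.
by rewrite Z mulr0.
Qed.

(** Once [sigma] and [rho] are ordered and the classes fixed, the left side is linear in the
    slowdowns with nonnegative coefficients, so their upper bounds suffice. The parameters nearly
    balance three cases: slowdowns [alpha] and [beta] (the maximum), [1/beta] and [alpha], and
    [1/alpha] with the other task never misrun. *)
Lemma two_task_bound (R : realFieldType) (q rho p sigma : R) :
  let alpha := 1 + 48 / 100 + 44 / 100 ^+ 2 in
  let beta := 1 + 18 / 100 + 54 / 100 ^+ 2 in
  let r := 79 / 100 + 32 / 100 ^+ 2 in
  misrun_class alpha beta r q rho -> misrun_class alpha beta r p sigma ->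
  1 + q * rho + p * sigma + q * p * (Num.max sigma rho - 1 - rho - sigma) <=
  1 + 67 / 100 + 37 / 100 ^+ 2 + 3 / 100 ^+ 3 + 56 / 100 ^+ 4.
Proof.
move=> alpha beta r; rewrite {}/alpha {}/beta {}/r.
by case: (leP sigma rho) => h; case=> [->|[-> ?]|[-> ?]|[[-> ?]|[-> ?]]];
  case=> [->|[-> ?]|[-> ?]|[[-> ?]|[-> ?]]]; lra.
Qed.

(* Parameters 1.4844, 1.1854, 0.7932.  The ratio is 1.67370356, i.e. 1.6737 to
   four decimals.  The literal value 1.6737 is false for these parameters: the
   two-task instances t^1 = (1, 1.4844 - e), t^2 = (1.1854, 1) have optimal
   makespan 1 and expected makespan 1.67370356 - 0.2068 e for small e > 0. *)
Theorem theorem3p1 (R : realFieldType) (n : nat) :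
  let M := gbm n (1 + 48 / 100 + 44 / 100 ^+ 2) (1 + 18 / 100 + 54 / 100 ^+ 2)
             (79 / 100 + 32 / 100 ^+ 2) (gbm_parameters_ok R) in
  universally_truthful M /\
  approximation_ratio M
    (1 + 67 / 100 + 37 / 100 ^+ 2 + 3 / 100 ^+ 3 + 56 / 100 ^+ 4).
Proof.
split=> [w|].
  apply: biased_mechanism_truthful => j.
  exact: bias_gt0 (gbm_parameters_ok R) _.
by apply: gbm_approximation => [|q rho p sigma]; [lra|apply: two_task_bound].
Qed.
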